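(* Let $R$ be an associative ring with unity and let $\mathbf{K}=(K,\leq_p)$ be an AEC with $K$ a class of left $R$-modules such that $K$ is closed under direct sums, under pure submodules, and under pure epimorphic images. If $\lambda$ is a cardinal with $\lambda^{|R|+\aleph_0}=\lambda$, then $\mathbf{K}$ is $\lambda$-stable.
   Context: $M\leq_p N$: $M$ is a pure submodule of $N$ (pp-formulas with parameters in $M$ true in $N$ are true in $M$). A pure epimorphism is a surjective homomorphism whose kernel is a pure submodule; $K$ is closed under pure epimorphic images if whenever $B\in K$ and $f:B\to C$ is a pure epimorphism then $C\in K$. An AEC $(K,\leq_p)$: $K$ closed under isomorphism and unions of $\leq_p$-chains, with a Löwenheim–Skolem number. Galois types: for $N\in K$, $A\subseteq N$, $b\in N$, $\mathbf{gtp}(b/A;N)$ is the class of $(b,A,N)$ under the transitive closure of: $(b_1,A,N_1)\sim(b_2,A,N_2)$ iff there are $N'\in K$ and pure embeddings $f_\ell:N_\ell\to N'$ fixing $A$ with $f_1(b_1)=f_2(b_2)$. $\mathbf{gS}(M)=\{\mathbf{gtp}(b/M;N):M\leq_pN\in K,b\in N\}$. $\mathbf{K}$ is $\lambda$-stable if $|\mathbf{gS}(M)|\leq\lambda$ for all $M\in K$ of cardinality $\lambda$.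
   Formalization: The cardinal λ is taken to be infinite: for λ = 1 the equation holds but the claim fails, since over the zero module the zero element and a nonzero element have different Galois types. *)

(* Defs.v *)
From HB Require Import structures.
From mathcomp Require Import all_boot all_algebra.
From Stdlib Require Import Relations.
From Stdlib Require List.
Set Implicit Arguments. Unset Strict Implicit. Unset Printing Implicit Defensive.
Import GRing.Theory.
Local Open Scope ring_scope.

Definition le_card (A B : Type) : Prop := exists f : A -> B, injective f.
Definition equipotent (A B : Type) : Prop := exists f : A -> B, bijective f.

(* A pp-formula phi(x_0..x_{n-1}) is (up to logical equivalence) of the form
     exists y_0..y_{k-1}, A x + B y = 0
   for matrices A : m x n, B : m x k over R.  [pp_sat A B a y] says that the
   tuple (a,y) satisfies the quantifier-free matrix part. *)
Definition pp_sat (R : pzRingType) (N : lmodType R) (m n k : nat)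
  (A : 'M[R]_(m, n)) (B : 'M[R]_(m, k)) (a : 'I_n -> N) (y : 'I_k -> N) : Prop :=
  forall r : 'I_m, \sum_(j < n) A r j *: a j + \sum_(l < k) B r l *: y l = 0.

Definition pure_in (R : pzRingType) (N : lmodType R) (P : N -> Prop) : Prop :=
  forall (m n k : nat) (A : 'M[R]_(m, n)) (B : 'M[R]_(m, k)) (a : 'I_n -> N),
    (forall j, P (a j)) ->
    (exists y : 'I_k -> N, pp_sat A B a y) ->
    exists y : 'I_k -> N, (forall l, P (y l)) /\ pp_sat A B a y.

(* A pure embedding: an injective homomorphism whose image is a pure submodule.
   (M <=_p N is modelled by a pure embedding of M into N.) *)
Definition pure_emb (R : pzRingType) (M N : lmodType R) (f : {linear M -> N}) : Prop :=
  injective f /\ pure_in (fun x : N => exists m : M, f m = x).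

Definition pure_epi (R : pzRingType) (B C : lmodType R) (f : {linear B -> C}) : Prop :=
  (forall c : C, exists b : B, f b = c) /\ pure_in (fun x : B => f x = 0).

Definition is_direct_sum (R : pzRingType) (I : Type) (M : I -> lmodType R)
  (N : lmodType R) (e : forall i, {linear M i -> N}) : Prop :=
  (forall x : N, exists s : seq {i : I & M i},
      x = \sum_(p <- s) e (projT1 p) (projT2 p)) /\
  (forall s : seq {i : I & M i},
      List.NoDup (map (fun p => projT1 p) s) ->
      \sum_(p <- s) e (projT1 p) (projT2 p) = 0 ->
      List.Forall (fun p : {i : I & M i} => projT2 p = 0 :> M (projT1 p)) s).

Definition closed_direct_sums (R : pzRingType) (K : lmodType R -> Prop) : Prop :=
  forall (I : Type) (M : I -> lmodType R) (N : lmodType R)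
         (e : forall i, {linear M i -> N}),
    (forall i, K (M i)) -> is_direct_sum e -> K N.

Definition closed_pure_sub (R : pzRingType) (K : lmodType R -> Prop) : Prop :=
  forall (M N : lmodType R) (h : {linear M -> N}), pure_emb h -> K N -> K M.

Definition closed_pure_epi (R : pzRingType) (K : lmodType R -> Prop) : Prop :=
  forall (B C : lmodType R) (f : {linear B -> C}), pure_epi f -> K B -> K C.

(* The axioms concerning only the relation <=_p (partial order, respecting
   isomorphism, coherence, M_i <=_p union, smoothness) hold automatically for
   the pure-submodule relation; the remaining ones are stated below. *)

Definition closed_iso (R : pzRingType) (K : lmodType R -> Prop) : Prop :=
  forall (M N : lmodType R) (f : {linear M -> N}), bijective f -> K M -> K N.

Definition well_order (I : Type) (lt : I -> I -> Prop) : Prop :=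
  well_founded lt /\ (forall i j k, lt i j -> lt j k -> lt i k) /\
  (forall i j, lt i j \/ i = j \/ lt j i).

(* Union of a <=_p-chain (M_i, f_ij) : N together with the inclusions g_i,
   i.e. N is covered by the images of the injective compatible maps g_i. *)
Definition closed_chain_unions (R : pzRingType) (K : lmodType R -> Prop) : Prop :=
  forall (I : Type) (lt : I -> I -> Prop) (M : I -> lmodType R)
         (f : forall i j, lt i j -> {linear M i -> M j})
         (N : lmodType R) (g : forall i, {linear M i -> N}),
    well_order lt ->
    (forall i j (h : lt i j), pure_emb (f i j h)) ->
    (forall i j k (hij : lt i j) (hjk : lt j k) (hik : lt i k) (x : M i),
        f j k hjk (f i j hij x) = f i k hik x) ->
    (forall i j (h : lt i j) (x : M i), g j (f i j h x) = g i x) ->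
    (forall i, injective (g i)) ->
    (forall y : N, exists i (x : M i), g i x = y) ->
    (forall i, K (M i)) -> K N.

Definition has_LS_number (R : pzRingType) (K : lmodType R -> Prop) : Prop :=
  exists LS : Type, le_card nat LS /\
    forall N : lmodType R, K N -> forall A : N -> Prop,
      exists (M : lmodType R) (h : {linear M -> N}),
        [/\ K M, pure_emb h, (forall x, A x -> exists m, h m = x)
          & le_card M ({x : N | A x} + LS)%type].

Definition is_pure_AEC (R : pzRingType) (K : lmodType R -> Prop) : Prop :=
  [/\ closed_iso K, closed_chain_unions K & has_LS_number K].

Record gtriple (R : pzRingType) (K : lmodType R -> Prop) (M : lmodType R) := GTriple {
  gN : lmodType R;
  gN_K : K gN;
  gi : {linear M -> gN};
  gi_pure : pure_emb gi;
  gb : gN }.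

Definition gatomic (R : pzRingType) (K : lmodType R -> Prop) (M : lmodType R)
  (t1 t2 : gtriple K M) : Prop :=
  exists (N' : lmodType R) (f1 : {linear gN t1 -> N'}) (f2 : {linear gN t2 -> N'}),
    [/\ K N', pure_emb f1, pure_emb f2,
        (forall m : M, f1 (gi t1 m) = f2 (gi t2 m)) & f1 (gb t1) = f2 (gb t2)].

Definition gtp_eq (R : pzRingType) (K : lmodType R -> Prop) (M : lmodType R) :
  gtriple K M -> gtriple K M -> Prop := clos_trans _ (@gatomic R K M).

(* |gS(M)| <= |L|: there are at most |L| Galois types over M, i.e. a family of
   representatives indexed by a set of size <= |L| meets every Galois type. *)
Definition few_gtypes (R : pzRingType) (K : lmodType R -> Prop) (M : lmodType R)
  (L : Type) : Prop :=
  exists (S : Type) (rep : S -> gtriple K M),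
    le_card S L /\ forall t : gtriple K M, exists s : S, gtp_eq t (rep s).

Definition stable (R : pzRingType) (K : lmodType R -> Prop) (L : Type) : Prop :=
  forall M : lmodType R, K M -> equipotent M L -> few_gtypes K M L.

(* Main.v *)
(* Given M <=_p N in K and b in N, close b under Skolem functions for pp-systems
   "z + c + B y = 0 with z in M" to get a submodule H of N.  Purity of M makes M + H
   pure in N.  Index H by a fixed set J of terms with lambda^|J| <= lambda.  The
   partial function F : J -> M recording which terms take a value in M, and which
   value, determines M + H over M together with b, and there are at most lambda such
   functions.  If two triples give the same F, then M + H and M + H' are isomorphic
   over M with b corresponding to b', and the pushout of N and N' along this
   isomorphism is a pure quotient of N x N', hence lies in K, and contains N and N'
   as pure submodules: the Galois types are equal. *)
Require Import Defs.
From mathcomp Require Import all_boot all_algebra.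
From HB Require Import structures.
From mathcomp Require Import boolp.
From Stdlib Require Import Relations.
From Stdlib Require List.
Set Implicit Arguments. Unset Strict Implicit. Unset Printing Implicit Defensive.
Import GRing.Theory.
Local Open Scope ring_scope.
Local Open Scope quotient_scope.

(** * Exponents J with |L|^|J| <= |L| *)

Section Exponents.
Variable L : Type.

Definition exponent (J : Type) : Prop := le_card (J -> L) L.

Lemma exponent_le (J J' : Type) (x0 : L) : le_card J' J -> exponent J -> exponent J'.
Proof.
move=> [f f_inj] [c c_inj].
pose ext (g : J' -> L) j :=
  if pselect (exists j', f j' = j) is left h then g (projT1 (cid h)) else x0.
exists (c \o ext) => g g' /c_inj eq_ext; apply: funext => j.
have := congr1 (@^~ (f j)) eq_ext; rewrite /ext.
case: pselect => [h|[]]; last by exists j.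
by case: (cid h) => /= j' /f_inj ->.
Qed.

(** A function on the sum is a family of functions on the [P j]. Each of these is coded by one
    element of [L], which leaves a function from [J] to [L]. *)
Lemma exponent_sigT (J : Type) (P : J -> Type) :
  exponent J -> (forall j, exponent (P j)) -> exponent {j : J & P j}.
Proof.
move=> [c c_inj] expP; pose d j := projT1 (cid (expP j)).
have d_inj j : injective (d j) by rewrite /d; case: cid.
exists (fun g => c (fun j => d j (fun p => g (existT P j p)))) => g g' /c_inj eq_d.
apply: funext => -[j p].
by have /d_inj /(congr1 (@^~ p)) := congr1 (@^~ j) eq_d.
Qed.

Hypothesis L_infinite : le_card nat L.
Hypothesis exp_nat : exponent nat.

Let x0 : L := projT1 (cid L_infinite) 0.

Lemma exponent_countable (J : Type) : le_card J nat -> exponent J.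
Proof. by move=> /(exponent_le x0); apply. Qed.

Lemma exponent_sum (J J' : Type) : exponent J -> exponent J' -> exponent (J + J')%type.
Proof.
move=> expJ expJ'.
have exp_bool : exponent bool.
  by apply: exponent_countable; exists nat_of_bool; case; case.
apply: (exponent_le x0 (J := {b : bool & if b then J else J'})).
  exists (fun s => match s with inl j => existT (fun b : bool => if b then J else J') true j
                              | inr j => existT _ false j end).
  by move=> [j|j] [j'|j'] //= E; rewrite (existT_inj2 E).
by apply: exponent_sigT; [ | case].
Qed.

Lemma exponent_prod (J J' : Type) : exponent J -> exponent J' -> exponent (J * J')%type.
Proof.
move=> expJ expJ'; apply: (exponent_le x0 (J := {_ : J & J'})).
  by exists (fun p => existT (fun=> J') p.1 p.2) => -[a b] [a' b'] /= [-> ->].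
exact: exponent_sigT.
Qed.

Lemma exponent_seq (J : Type) : exponent J -> exponent (seq J).
Proof.
move=> expJ; apply: (exponent_le x0 (J := {n & n.-tuple J})).
  exists (fun s => existT (fun n => n.-tuple J) (size s) (in_tuple s)).
  by move=> s s' E; have := congr1 (fun p : {n & n.-tuple J} => tval (projT2 p)) E.
apply: exponent_sigT => // n; elim: n => [|n IHn].
  by apply: exponent_countable; exists (fun=> 0) => u v _; rewrite (tuple0 u) (tuple0 v).
apply: (exponent_le x0 (J := (J * n.-tuple J)%type)); last exact: exponent_prod.
exists (fun u => (thead u, [tuple of behead u])) => u v [].
case/tupleP: u => a u; case/tupleP: v => b v; rewrite !theadE /= => -> E.
by apply: val_inj; rewrite /= E.
Qed.

Lemma exponent_tree (J : Type) : exponent J -> exponent (GenTree.tree J).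
Proof.
move=> expJ; apply: (exponent_le x0 (J := seq (nat + J))).
  by exists (@GenTree.encode J); apply: pcan_inj (GenTree.codeK J).
exact/exponent_seq/exponent_sum.
Qed.

(** Two elements of [L] code an optional value: at [false] a tag [f 0] or [f 1] separating [Some]
    from [None], at [true] the value itself if there is one. *)
Lemma exponent_option_fun (J : Type) : exponent J -> le_card (J -> option L) L.
Proof.
move=> expJ; have [f f_inj] := L_infinite.
have [c c_inj] : exponent (J * bool)%type.
  by apply: exponent_prod => //; apply: exponent_countable; exists nat_of_bool; case; case.
pose h (o : option L) (b : bool) :=
  if o is Some x then (if b then x else f 0) else f 1.
exists (fun g => c (fun p => h (g p.1) p.2)) => g g' /c_inj E.
apply: funext => j.
have := congr1 (@^~ (j, false)) E; have := congr1 (@^~ (j, true)) E; rewrite /h /=.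
by case: (g j) (g' j) => [x|] [x'|] // => [-> //|_ /f_inj|_ /f_inj].
Qed.

End Exponents.

(** * Quotients and amalgamation *)

Section Quotient.
Variables (R : pzRingType) (P : lmodType R) (D : P -> Prop).
Hypothesis D0 : D 0.
Hypothesis Dlin : forall a x y, D x -> D y -> D (a *: x + y).

Let Db : {pred P} := fun x => `[< D x >].

Fact Db_zmod_closed : zmod_closed Db.
Proof.
split=> [|x y /asboolP Dx /asboolP Dy]; first exact/asboolP.
by apply/asboolP; rewrite addrC -scaleN1r; apply: Dlin.
Qed.
HB.instance Definition _ := GRing.isZmodClosed.Build P Db Db_zmod_closed.

Local Notation Q := (Quotient.quot Db).

Lemma quot_eqP (x y : P) : \pi_Q x = \pi_Q y <-> D (x - y).
Proof.
split=> [/eqP|Dxy]; first by rewrite -Quotient.idealrBE => /asboolP.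
by apply/eqP; rewrite -Quotient.idealrBE; apply/asboolP.
Qed.

Definition quot_scale (a : R) (x : Q) : Q := \pi_Q (a *: repr x).

Lemma quot_scaleE a x : quot_scale a (\pi_Q x) = \pi_Q (a *: x).
Proof.
apply/quot_eqP; rewrite -scalerBr -[_ *: _]addr0; apply: Dlin => //.
by apply/quot_eqP; rewrite reprK.
Qed.

Fact quot_scalerA a b v : quot_scale a (quot_scale b v) = quot_scale (a * b) v.
Proof. by rewrite -[v]reprK [quot_scale b _]quot_scaleE !quot_scaleE scalerA. Qed.
Fact quot_scale1r : left_id 1 quot_scale.
Proof. by move=> v; rewrite -[v]reprK quot_scaleE scale1r. Qed.
Fact quot_scalerDr : right_distributive quot_scale +%R.
Proof.
by move=> a u v; rewrite -[u]reprK -[v]reprK -raddfD !quot_scaleE scalerDr raddfD.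
Qed.
Fact quot_scalerDl v : {morph quot_scale^~ v : a b / a + b}.
Proof. by move=> a b; rewrite -[v]reprK !quot_scaleE scalerDl raddfD. Qed.

Lemma exists_quotient : exists (Q : lmodType R) (q : {linear P -> Q}),
  (forall z, exists x, q x = z) /\ forall x, q x = 0 <-> D x.
Proof.
pose m := GRing.Zmodule_isLmodule.Build R Q
  quot_scalerA quot_scale1r quot_scalerDr quot_scalerDl.
pose Q' : lmodType R := HB.pack Q m.
have lin_pi : linear (\pi_Q : P -> Q').
  move=> a x y; rewrite raddfD /=; congr (_ + _).
  by rewrite -quot_scaleE.
pose lm := GRing.isLinear.Build R P Q' _ (\pi_Q : P -> Q') lin_pi.
pose q : {linear P -> Q'} := HB.pack (\pi_Q : P -> Q') lm.
exists Q', q; split=> [z|x]; first by exists (repr z); rewrite /= reprK.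
have <- : \pi_Q (0 : P) = 0 :> Q by rewrite raddf0.
by rewrite /= quot_eqP subr0.
Qed.
End Quotient.

(** * Submodules, purity and pushouts *)

Definition submodule (R : pzRingType) (N : lmodType R) (P : N -> Prop) : Prop :=
  P 0 /\ forall a x y, P x -> P y -> P (a *: x + y).

Section Submodule.
Variables (R : pzRingType) (N : lmodType R) (P : N -> Prop).
Hypothesis subP : submodule P.

Lemma submoduleD x y : P x -> P y -> P (x + y).
Proof. by rewrite -{2}[x]scale1r; case: subP => _; apply. Qed.

Lemma submodule_comb (k : nat) (a : 'I_k -> R) (x : 'I_k -> N) :
  (forall l, P (x l)) -> P (\sum_l a l *: x l).
Proof.
by move=> Px; elim/big_ind: _ => [||l _]; [case: subP | exact: submoduleD |
  rewrite -[_ *: _]addr0; apply subP.2; [exact: Px | case: subP]].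
Qed.

(* For a submodule, the parameters of a pp-system may be taken to be its constant terms. *)
Lemma pure_submoduleP : pure_in P <->
  forall (m k : nat) (B : 'M[R]_(m, k)) (c : 'I_m -> N), (forall r, P (c r)) ->
    (exists y : 'I_k -> N, forall r, c r + \sum_l B r l *: y l = 0) ->
    exists y : 'I_k -> N, (forall l, P (y l)) /\ forall r, c r + \sum_l B r l *: y l = 0.
Proof.
split=> [pureP m k B c Pc [y cy]|pureP m n k A B a Pa [y ay]]; last first.
  by apply: pureP => [r|]; [exact: submodule_comb | exists y].
(* With the identity matrix as [A], constant terms become parameters. *)
have idE r : \sum_j (1%:M : 'M[R]_m) r j *: c j = c r.
  rewrite (bigD1 r) //= big1 ?addr0 ?mxE ?eqxx ?scale1r // => j /negPf jr.
  by rewrite mxE eq_sym jr scale0r.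
have [|y' [Py' cy']] := pureP m m k 1%:M B c Pc.
  by exists y => r; rewrite idE.
by exists y'; split=> // r; rewrite -[RHS](cy' r) idE.
Qed.
End Submodule.

Lemma image_submodule (R : pzRingType) (M N : lmodType R) (f : {linear M -> N}) :
  submodule (fun x => exists m, f m = x).
Proof.
split=> [|a _ _ [x <-] [y <-]]; first by exists 0; rewrite raddf0.
by exists (a *: x + y); rewrite linearP.
Qed.

Lemma comb_pair (R : pzRingType) (N1 N2 : lmodType R) (k : nat) (a : 'I_k -> R)
    (x : 'I_k -> (N1 * N2)%type) :
  \sum_l a l *: x l = (\sum_l a l *: (x l).1, \sum_l a l *: (x l).2).
Proof. by apply: injective_projections => /=; rewrite raddf_sum. Qed.

(** Write a solution in [Q] as [f1 u + f2 v]. Here [v] solves a system with constants in the range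
    of [G], so purity gives a solution [w'] inside that range. If [w] is a [G]-partner of [w'], then
    [u + w] solves the original system in [N1]. *)
Lemma pushout_inl_pure (R : pzRingType) (N1 N2 Q : lmodType R) (G : N1 -> N2 -> Prop)
    (f1 : {linear N1 -> Q}) (f2 : {linear N2 -> Q}) :
  submodule (fun p : N1 * N2 => G p.1 p.2) ->
  (forall x, G x 0 -> x = 0) ->
  pure_in (fun y => exists x, G x y) ->
  (forall z, exists x y, z = f1 x + f2 y) ->
  (forall x y, f1 x + f2 y = 0 -> G x (- y)) ->
  pure_emb f1.
Proof.
move=> subG G0 pureG onto ker; split.
  apply: raddf_inj => x fx0; apply: G0; rewrite -[0]oppr0; apply: ker.
  by rewrite fx0 raddf0 addr0.
apply/pure_submoduleP => [|m k B c /choice [c0 c0E] [y cy]]; first exact: image_submodule.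
have [u /choice [v yE]] := choice (fun l => onto (y l)).
pose d r := - \sum_l B r l *: v l.
have Gd r : G (c0 r + \sum_l B r l *: u l) (d r).
  apply: ker; rewrite -[RHS](cy r) raddfD /= c0E -addrA !raddf_sum -big_split /=.
  by congr (_ + _); apply: eq_bigr => l _; rewrite yE scalerDr !linearZ.
have subI : submodule (fun y => exists x, G x y).
  split=> [|a y1 y2 [x1 Gx1] [x2 Gx2]]; first by exists 0; case: subG.
  by exists (a *: x1 + x2); apply: (subG.2 a (x1, y1) (x2, y2)).
have [||w' [/choice [w Gw] dw']] := (pure_submoduleP subI).1 pureG m k B d.
- by move=> r; exists (c0 r + \sum_l B r l *: u l).
- by exists v => r; rewrite addNr.
exists (fun l => f1 (u l + w l)); split=> [l|r]; first by exists (u l + w l).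
suff /(congr1 f1) : c0 r + \sum_l B r l *: (u l + w l) = 0.
  rewrite [RHS]linear0 => E; rewrite -[RHS]E -c0E linearD linear_sum; congr (_ + _).
  by apply: eq_bigr => l _; rewrite linearZ.
(* The left side is [G]-related to [d r + \sum_l B r l *: w' l], which is 0. *)
apply: G0; rewrite -(dw' r).
have := submoduleD subG (x := (_, _)) (y := (_, _)) (Gd r)
  (submodule_comb subG (fun l => B r l) (x := fun l => (w l, w' l)) Gw).
rewrite comb_pair /= -addrA -big_split /=.
by under eq_bigr do rewrite -scalerDr.
Qed.

Section BinarySum.
Variables (R : pzRingType) (N1 N2 : lmodType R).

Definition pair_inl (x : N1) : N1 * N2 := (x, 0).
Definition pair_inr (y : N2) : N1 * N2 := (0, y).

Fact pair_inl_linear : linear pair_inl.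
Proof. by move=> a x y; congr pair; rewrite /= scaler0 addr0. Qed.
Fact pair_inr_linear : linear pair_inr.
Proof. by move=> a x y; congr pair; rewrite /= scaler0 addr0. Qed.
HB.instance Definition _ :=
  GRing.isLinear.Build R N1 (N1 * N2)%type _ pair_inl pair_inl_linear.
HB.instance Definition _ :=
  GRing.isLinear.Build R N2 (N1 * N2)%type _ pair_inr pair_inr_linear.

Lemma pair_inlr (p : N1 * N2) : p = pair_inl p.1 + pair_inr p.2.
Proof. by apply: injective_projections; rewrite /= ?addr0 ?add0r. Qed.

Lemma prod_closed (K : lmodType R -> Prop) :
  closed_direct_sums K -> K N1 -> K N2 -> K (N1 * N2)%type.
Proof.
pose F (b : bool) : lmodType R := if b then N1 else N2.
pose e (b : bool) : {linear F b -> (N1 * N2)%type} :=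
  if b return {linear F b -> (N1 * N2)%type} then pair_inl else pair_inr.
move=> sumK K1 K2; apply: (sumK bool F _ e) => [[]//|]; split=> [p|].
  exists [:: existT F true p.1; existT F false p.2].
  by rewrite !big_cons big_nil addr0 /= -pair_inlr.
move=> s; have notin b x l : List.NoDup (x :: b :: l) -> x <> b :> bool.
  by move/List.NoDup_cons_iff => [nx _] xb; apply: nx; left.
(* A list of distinct booleans has at most two entries. *)
case: s => [|[b1 x1] [|[b2 x2] [|[b3 x3] s]]] /=.
- by move=> _ _; constructor.
- rewrite big_cons big_nil addr0 => _ /= E; constructor=> //=.
  by case: b1 x1 E => x1 [].
- rewrite !big_cons big_nil addr0 => /notin /= ne E.
  case: b1 b2 x1 x2 ne E => [] [] // x1 x2 _ [];
  by rewrite ?addr0 ?add0r => E1 E2; repeat constructor.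
- move=> nodup; exfalso; have ne12 := notin _ _ _ nodup.
  move/List.NoDup_cons_iff: nodup => [n1 n23]; have ne23 := notin _ _ _ n23.
  have ne13 : b1 <> b3 by move=> eq13; apply: n1; right; left.
  by case: (b1) (b2) (b3) ne12 ne23 ne13 => [] [] [].
Qed.

(* The amalgam is the pushout of N1 and N2 along the partial isomorphism with graph G. *)
Lemma amalgamation (K : lmodType R -> Prop) (G : N1 -> N2 -> Prop) :
  closed_direct_sums K -> closed_pure_epi K -> K N1 -> K N2 ->
  submodule (fun p : N1 * N2 => G p.1 p.2) ->
  (forall x, G x 0 -> x = 0) -> (forall y, G 0 y -> y = 0) ->
  pure_in (fun x => exists y, G x y) -> pure_in (fun y => exists x, G x y) ->
  exists (Q : lmodType R) (f1 : {linear N1 -> Q}) (f2 : {linear N2 -> Q}),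
    [/\ K Q, pure_emb f1, pure_emb f2 & forall x y, G x y -> f1 x = f2 y].
Proof.
move=> sumK epiK K1 K2 subG G10 G20 pure1 pure2.
(* The kernel of the pushout map: since (x, y) goes to [f1 x + f2 y], it must vanish exactly when x
   is identified with -y. *)
pose D (p : N1 * N2) := G p.1 (- p.2).
have GD a x y x' y' : G x y -> G x' y' -> G (a *: x + x') (a *: y + y').
  exact: (subG.2 a (x, y) (x', y')).
have G00 : G 0 0 by case: subG.
have GN x y : G x y -> G (- x) (- y).
  by move=> /(GD (-1) _ _ 0 0) /(_ G00); rewrite !scaleN1r !addr0.
have D0 : D 0 by rewrite /D /= oppr0.
have Dlin a p q : D p -> D q -> D (a *: p + q).
  by rewrite /D /= opprD -scalerN; apply: GD.
have [Q [q [onto ker]]] := exists_quotient D0 Dlin.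
have qE x y : (q \o pair_inl) x + (q \o pair_inr) y = q (x, y).
  by rewrite /= -linearD; congr (q _); rewrite [RHS]pair_inlr.
have ontoE z : exists x y, z = (q \o pair_inl) x + (q \o pair_inr) y.
  by have [[x y] <-] := onto z; exists x, y; rewrite qE.
exists Q, (q \o pair_inl), (q \o pair_inr); split.
- apply: (epiK _ _ q); last exact: prod_closed.
  split; first exact: onto.
  have -> : (fun p => q p = 0) = D by apply: funext => p; apply: propext.
  apply/pure_submoduleP => [|m k B c Dc [y cy]]; first by split.
  have sub1 : submodule (fun x => exists y, G x y).
    split=> [|a x1 x2 [y1 Gy1] [y2 Gy2]]; first by exists 0.
    by exists (a *: y1 + y2); apply: GD.
  (* Purity solves the first coordinates inside the domain of [G]. The negated [G]-partners then
     solve the second ones, because [G 0 y] forces [y = 0]. *)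
  have [||u [/choice [v Guv] cu]] :=
      (pure_submoduleP sub1).1 pure1 m k B (fun r => (c r).1).
  + by move=> r; exists (- (c r).2); exact: Dc.
  + by exists (fun l => (y l).1) => r; have := congr1 fst (cy r); rewrite comb_pair.
  exists (fun l => (u l, - v l)); split=> [l|r]; first by rewrite /D /= opprK.
  rewrite comb_pair; apply: injective_projections; rewrite /= ?cu //.
  apply: oppr_inj; rewrite oppr0; apply: G20; rewrite -(cu r) opprD -sumrN.
  under [X in G _ (_ + X)]eq_bigr do rewrite -scalerN opprK.
  have := submodule_comb subG (fun l => B r l) (x := fun l => (u l, v l)) Guv.
  by rewrite comb_pair => /(submoduleD subG (x := (_, _)) (y := (_, _)) (Dc r)).
- apply: (pushout_inl_pure subG G10 pure2 ontoE) => x y.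
  by rewrite qE ker.
- apply: (@pushout_inl_pure _ _ _ _ (fun y x => G x y) _ (q \o pair_inl)) => //.
  + by split=> // a p p'; apply: GD.
  + by move=> z; have [x [y ->]] := ontoE z; exists y, x; rewrite addrC.
  + by move=> y x; rewrite addrC qE ker /D /= => /GN; rewrite opprK.
- move=> x y Gxy; apply/eqP; rewrite -subr_eq0 -raddfN qE.
  by apply/eqP/ker; rewrite /D /= opprK.
Qed.
End BinarySum.

(** * Skolem hulls *)

Definition pp_matrix (R : pzRingType) : Type := {d : nat * nat & 'M[R]_(d.1, d.2)}.

(* [Leaf _] denotes b; a node whose first child is [Leaf (inl r)] denotes the linear
   combination r t + u of its next two children; a node numbered l whose first child
   is [Leaf (inr B)] denotes the l-th coordinate of a chosen solution y in N of
   z + c + B y = 0 with z in M, where c is the tuple of its other children. *)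
Notation skolem_term R := (GenTree.tree (R + pp_matrix R)%type).

Section Skolem.
Variables (R : pzRingType) (M N : lmodType R) (i : {linear M -> N}) (b : N).

(** Solvability modulo M. Leaving [z] unspecified keeps elements of M out of the terms, whose number
    then depends on [R] only. *)
Definition solves m k (B : 'M[R]_(m, k)) (c : 'I_m -> N) (y : 'I_k -> N) : Prop :=
  exists z : 'I_m -> M, forall r, i (z r) + c r + \sum_l B r l *: y l = 0.

Definition solution m k (B : 'M[R]_(m, k)) (c : 'I_m -> N) : 'I_k -> N :=
  if pselect (exists y, solves B c y) is left h then projT1 (cid h) else fun=> 0.

Lemma solutionP m k (B : 'M[R]_(m, k)) c y : solves B c y -> solves B c (solution B c).
Proof.
move=> sol; rewrite /solution; case: pselect => [h|[]]; last by exists y.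
by case: cid.
Qed.

(** The first entry of [vs] comes from the leaf labelling the operation, so arguments start at index
    1. Ill-formed nodes and out-of-range [l] get the value 0. *)
Definition skolem_step (l : nat) (ts : seq (skolem_term R)) (vs : seq N) : N :=
  match ts with
  | GenTree.Leaf (inl r) :: _ => r *: vs`_1 + vs`_2
  | GenTree.Leaf (inr B) :: _ =>
      oapp (solution (projT2 B) (fun r => vs`_r.+1)) 0 (insub l)
  | _ => 0
  end.

Fixpoint skolem_eval (t : skolem_term R) : N :=
  match t with
  | GenTree.Leaf _ => b
  | GenTree.Node l ts => skolem_step l ts (map skolem_eval ts)
  end.

Definition skolem_base : skolem_term R := GenTree.Leaf (inl 0).

Definition skolem_zero : skolem_term R := GenTree.Node 0 [::].

Definition skolem_comb (r : R) (t u : skolem_term R) : skolem_term R :=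
  GenTree.Node 0 [:: GenTree.Leaf (inl r); t; u].

Lemma skolem_eval_comb r t u :
  skolem_eval (skolem_comb r t u) = r *: skolem_eval t + skolem_eval u.
Proof. by []. Qed.

Lemma skolem_solution m k (B : 'M[R]_(m, k)) (t : 'I_m -> skolem_term R) y :
  solves B (fun r => skolem_eval (t r)) y ->
  exists u : 'I_k -> skolem_term R,
    solves B (fun r => skolem_eval (t r)) (fun l => skolem_eval (u l)).
Proof.
move=> /solutionP sol; pose B' : pp_matrix R := existT _ (m, k) B.
pose u (l : 'I_k) := GenTree.Node l (GenTree.Leaf (inr B') :: [seq t r | r <- enum 'I_m]).
exists u; suff -> : (fun l => skolem_eval (u l)) = solution B (fun r => skolem_eval (t r)).
  exact: sol.
apply: funext => l /=; rewrite valK /=; congr (solution B _ l).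
apply: funext => r; rewrite -map_comp (nth_map r) ?size_enum_ord //.
by rewrite nth_ord_enum.
Qed.

Definition hull (x : N) : Prop := exists m t, x = i m + skolem_eval t.

(** A solution in N of a system over the hull yields a Skolem solution modulo M; purity of M then
    supplies a correction in M. *)
Lemma hull_pure : pure_emb i -> pure_in hull.
Proof.
move=> [_ pure_i]; have sub_hull : submodule hull.
  split=> [|a _ _ [m [t ->]] [m' [t' ->]]].
    by exists 0, skolem_zero; rewrite raddf0 addr0.
  exists (a *: m + m'), (skolem_comb a t t').
  by rewrite skolem_eval_comb linearP scalerDr addrACA.
apply/pure_submoduleP => // m k B c /choice [c0 /choice [t cE]] [y cy].
have [|u [z uz]] := @skolem_solution m k B t y.
  by exists c0 => r; rewrite -cE.
(* y minus the Skolem solution solves a system with constants in M. *)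
have [||w [/choice [w0 w0E] w_sol]] :=
  (pure_submoduleP (image_submodule i)).1 pure_i m k B (fun r => i (c0 r - z r)).
- by move=> r; exists (c0 r - z r).
- exists (fun l => y l - skolem_eval (u l)) => r.
  under eq_bigr do rewrite scalerBr.
  have := congr2 (fun x x' => x - x') (cy r) (uz r); rewrite subr0 => E.
  by rewrite -[RHS]E cE [in RHS]opprD [RHS]addrACA [i (z r) + _]addrC addrKA raddfB sumrB.
exists (fun l => w l + skolem_eval (u l)); split=> [l|r].
  by exists (w0 l), (u l); rewrite w0E.
under eq_bigr do rewrite scalerDr.
have := congr2 +%R (w_sol r) (uz r); rewrite addr0 => E.
by rewrite -[RHS]E [RHS]addrACA raddfB subrKA -cE big_split.
Qed.
End Skolem.

Lemma exponent_skolem_term (R : pzRingType) (L : Type) :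
  le_card nat L -> exponent L nat -> exponent L R -> exponent L (skolem_term R).
Proof.
move=> Linf expN expR; have [c _] := Linf.
apply: exponent_tree => //; apply: exponent_sum => //.
apply: exponent_sigT => [|[m n]]; first exact: exponent_prod.
apply: (exponent_le (c 0) (J := seq R)); last exact: exponent_seq.
exists (fun B : 'M[R]_(m, n) => tval (fgraph (mx_val B))) => B B' E.
by apply: val_inj; apply: (can_inj fgraphK); apply: val_inj.
Qed.

(** * Galois types determined by Skolem data *)

Section SkolemData.
Variables (R : pzRingType) (K : lmodType R -> Prop) (M : lmodType R).

Definition skolem_data (t : gtriple K M) (s : skolem_term R) : option M :=
  if pselect (exists m, gi t m = skolem_eval (gi t) (gb t) s) is left h
  then Some (projT1 (cid h)) else None.

Lemma skolem_dataP t s m :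
  skolem_data t s = Some m <-> gi t m = skolem_eval (gi t) (gb t) s.
Proof.
have [i_inj _] := gi_pure t; rewrite /skolem_data; case: pselect => [h|nh].
  by case: cid => /= m' m'E; split=> [[<-]//|]; rewrite -m'E => /i_inj ->.
by split=> // mE; case: nh; exists m.
Qed.

Lemma skolem_data_gatomic t t' :
  closed_direct_sums K -> closed_pure_epi K ->
  skolem_data t = skolem_data t' -> gatomic t t'.
Proof.
move=> sumK epiK data_eq; pose ev (u : gtriple K M) := skolem_eval (gi u) (gb u).
pose G x y := exists m s, x = gi t m + ev t s /\ y = gi t' m + ev t' s.
(* The equation says that [s] takes the value [- m] in M, which the data record. This makes [G] the
   graph of an isomorphism between the two hulls. *)
have transfer (u u' : gtriple K M) m s : skolem_data u = skolem_data u' ->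
    gi u m + ev u s = 0 -> gi u' m + ev u' s = 0.
  move=> E; rewrite addrC => /eqP; rewrite addr_eq0 -raddfN => /eqP/esym/skolem_dataP.
  by rewrite E => /skolem_dataP; rewrite /ev => <-; rewrite raddfN subrr.
have [|x|y|||Q [f1 [f2 [KQ pf1 pf2 f12]]]] :=
    @amalgamation R _ _ K G sumK epiK (gN_K t) (gN_K t').
- split=> [|a [x y] [x' y'] [m [s [/= -> ->]]] [m' [s' [/= -> ->]]]].
    by exists 0, (skolem_zero R); rewrite /= !raddf0 !addr0.
  exists (a *: m + m'), (skolem_comb a s s').
  by rewrite /ev !skolem_eval_comb !linearP !scalerDr /= !(addrACA _ (a *: skolem_eval _ _ _)).
- by move=> [m [s [-> /esym]]]; apply: transfer.
- by move=> [m [s [/esym E ->]]]; apply: transfer E.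
- have -> : (fun x => exists y, G x y) = hull (gi t) (gb t).
    apply: funext => x; apply: propext; split=> [[y [m [s [-> _]]]]|[m [s ->]]].
      by exists m, s.
    by exists (gi t' m + ev t' s), m, s.
  exact/hull_pure/gi_pure.
- have -> : (fun y => exists x, G x y) = hull (gi t') (gb t').
    apply: funext => y; apply: propext; split=> [[x [m [s [_ ->]]]]|[m [s ->]]].
      by exists m, s.
    by exists (gi t m + ev t s), m, s.
  exact/hull_pure/gi_pure.
(* The base term matches the two distinguished elements; the zero term gives agreement on M. *)
exists Q, f1, f2; split=> //; last first.
  by apply: f12; exists 0, (skolem_base R); rewrite !raddf0 !add0r.
move=> m; apply: f12; exists m, (skolem_zero R).
by rewrite /ev /= !addr0.
Qed.
End SkolemData.

(* lambda = |L|;  lambda^(|R| + aleph_0) = lambda  is  |(R + nat) -> L| = |L|. *)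
Theorem theorem4p12 (R : pzRingType) (K : lmodType R -> Prop) (L : Type) :
  is_pure_AEC K ->
  closed_direct_sums K -> closed_pure_sub K -> closed_pure_epi K ->
  le_card nat L ->
  equipotent ((R + nat)%type -> L) L ->
  stable K L.
Proof.
move=> _ sumK _ epiK Linf [c c_bij] M KM [d d_bij]; have [x _] := Linf.
have expRN : exponent L (R + nat)%type by exists c; apply: bij_inj.
have expN : exponent L nat.
  by apply: (exponent_le (x 0) _ expRN); exists inr => ? ? [].
have expR : exponent L R.
  by apply: (exponent_le (x 0) _ expRN); exists inl => ? ? [].
have [g g_inj] := exponent_option_fun Linf expN (exponent_skolem_term Linf expN expR).
(* The bijection [d] from M to [L] turns the data into a partial function with values in [L], which
   [g] codes by one element. *)
pose code (t : gtriple K M) : L := g (omap d \o skolem_data t).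
(* Only attained codes index representatives, one triple being chosen for each. *)
pose S := {l : L | exists t, code t = l}.
exists S, (fun l : S => projT1 (cid (proj2_sig l))); split.
  by exists sval => -[l p] [l' p'] /= E; apply: eq_exist.
move=> t; have ct : exists t', code t' = code t by exists t.
exists (exist _ (code t) ct : S); apply: t_step; apply: skolem_data_gatomic => //.
case: cid => t' /= /g_inj E; apply: funext => s.
by have /esym/(inj_omap (bij_inj d_bij)) := congr1 (@^~ s) E.
Qed.
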